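(* For all $n \geq 0$, the poset $(\mathcal{TBT}_n, \leq_{\mathrm{B}})$ is a lattice.
   Context: Binary trees are planar; each internal node (called node) has a left and a right child, possibly a leaf; a tree with $n$ nodes has $n+1$ leaves; $\perp$ is the empty tree. The canopy $\mathrm{cnp}(T)$ of a binary tree $T$ is the word on $\{0,1\}$ obtained by reading the leaves of $T$ from left to right, omitting the first and the last one, writing $0$ if the leaf is oriented to the right (is the right child of its parent) and $1$ otherwise. A pair of twin binary trees is a pair $(T_L,T_R)$ of binary trees with the same number $n$ of nodes such that $\mathrm{cnp}(T_L)_i \neq \mathrm{cnp}(T_R)_i$ for all $1 \leq i \leq n-1$. $\mathcal{TBT}_n$ is the set of pairs of twin binary trees in which each tree has $n$ nodes. $\mathfrak{S}_n$ is the set of permutations of size $n$, seen as words $\sigma_1 \cdots \sigma_n$. The permutohedron order $\leq_{\mathrm{P}}$ on $\mathfrak{S}_n$ is the partial order whose covering relations are: $\sigma$ is covered by $\nu$ if $\sigma = u\,a\,b\,v$ and $\nu = u\,b\,a\,v$ with letters $a < b$. For $\sigma \in \mathfrak{S}_n$, $\mathbb{P}(\sigma) = (T_L, T_R)$ is the pair of unlabeled trees (shapes) obtained as follows. Start with $(\perp,\perp)$ and insert the letters of $\sigma$ from left to right, inserting each letter $a$ by a leaf insertion in $T_L$ and a root insertion in $T_R$; at the end forget the labels. Leaf insertion of $a$ in a labeled tree: if the tree is empty the result is the one-node tree labeled $a$; otherwise, if $a$ is smaller than the root's label, leaf-insert $a$ in the left subtree, else in the right subtree. Root insertion of $a$ in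 a binary search tree $T$: the result has a root labeled $a$, left subtree $T_{\leq a}$ and right subtree $T_{>a}$, where $T_{\leq a}$ (resp. $T_{>a}$) is the binary search tree on exactly the nodes of $T$ with label $\leq a$ (resp. $>a$) such that if $x$ is an ancestor of $y$ in it, then $x$ is an ancestor of $y$ in $T$. The pair $\mathbb{P}(\sigma)$ belongs to $\mathcal{TBT}_n$. The order $\leq_{\mathrm{B}}$ on $\mathcal{TBT}_n$ is defined by: $J_0 \leq_{\mathrm{B}} J_1$ if there exist $\sigma_0, \sigma_1 \in \mathfrak{S}_n$ such that $\mathbb{P}(\sigma_0) = J_0$, $\mathbb{P}(\sigma_1) = J_1$ and $\sigma_0 \leq_{\mathrm{P}} \sigma_1$. *)

(* Defs.v *)
From Stdlib Require Import Relation_Operators.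
From mathcomp Require Import all_boot all_order.

Set Implicit Arguments.
Unset Strict Implicit.
Unset Printing Implicit Defensive.

(* Planar binary trees whose internal nodes carry labels in A; [bintree unit]
   is the type of unlabeled trees, and [Leaf] alone is the empty tree. *)
Inductive bintree (A : Type) : Type :=
| Leaf : bintree A
| Node : bintree A -> A -> bintree A -> bintree A.

Arguments Leaf {A}.

Fixpoint nb_nodes A (t : bintree A) : nat :=
  if t is Node l _ r then (nb_nodes l + nb_nodes r).+1 else 0.

Fixpoint shape A (t : bintree A) : bintree unit :=
  if t is Node l _ r then Node (shape l) tt (shape r) else Leaf.

Fixpoint labels A (t : bintree A) : seq A :=
  if t is Node l x r then labels l ++ x :: labels r else [::].

(* Letters 0 and 1 are [false] and [true]: a leaf is read as 0 when it is a
   right child and as 1 when it is a left child.  [leaf_word b t] reads the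
   leaves of [t] from left to right; [b] is the letter of [t] itself in case it
   is a leaf.  For the whole tree [b] is irrelevant, since then that leaf is
   the first one and is omitted from the canopy. *)
Fixpoint leaf_word A (b : bool) (t : bintree A) : seq bool :=
  if t is Node l _ r then leaf_word true l ++ leaf_word false r else [:: b].

Definition omit_first_last (T : Type) (s : seq T) : seq T :=
  take (size s).-2 (behead s).

Definition canopy A (t : bintree A) : seq bool :=
  omit_first_last (leaf_word true t).

Definition is_twin (n : nat) (J : bintree unit * bintree unit) : bool :=
  [&& nb_nodes J.1 == n, nb_nodes J.2 == n
    & [forall i : 'I_n.-1,
        nth false (canopy J.1) i != nth false (canopy J.2) i]].

Definition TBT (n : nat) : Type :=
  {J : bintree unit * bintree unit | is_twin n J}.

(* Permutations of size n as words on {1, ..., n}. *)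
Definition is_perm_word (n : nat) (s : seq nat) : bool := perm_eq s (iota 1 n).

Inductive permutohedron_cover : seq nat -> seq nat -> Prop :=
| PermutohedronCover (u v : seq nat) (a b : nat) :
    a < b -> permutohedron_cover (u ++ [:: a, b & v]) (u ++ [:: b, a & v]).

(* A cover only exchanges letters, so this relation on words does not leave the
   set of permutations of size n. *)
Definition permutohedron_le : seq nat -> seq nat -> Prop :=
  clos_refl_trans (seq nat) permutohedron_cover.

Fixpoint leaf_insert (a : nat) (t : bintree nat) : bintree nat :=
  if t is Node l x r then
    if a < x then Node (leaf_insert a l) x r else Node l x (leaf_insert a r)
  else Node Leaf a Leaf.

Fixpoint is_bst (t : bintree nat) : bool :=
  if t is Node l x r then
    [&& all (fun y => y <= x) (labels l), all (fun y => x < y) (labels r),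
        is_bst l & is_bst r]
  else true.

(* Nodes are identified with their labels, which are pairwise distinct in all
   the trees built from a permutation. *)
Fixpoint is_ancestor (t : bintree nat) (x y : nat) : bool :=
  if t is Node l z r then
    [|| (x == z) && ((y \in labels l) || (y \in labels r)),
        is_ancestor l x y | is_ancestor r x y]
  else false.

(* [is_restriction p t u]: [u] is the binary search tree on exactly the nodes
   of [t] whose label satisfies [p], with no ancestor pair absent from [t]. *)
Definition is_restriction (p : pred nat) (t u : bintree nat) : Prop :=
  [/\ is_bst u, perm_eq (labels u) (filter p (labels t))
    & forall x y, is_ancestor u x y -> is_ancestor t x y].

Inductive root_insertion (a : nat) (t : bintree nat) : bintree nat -> Prop :=
| RootInsertion (l r : bintree nat) :
    is_restriction (fun x => x <= a) t l ->
    is_restriction (fun x => a < x) t r ->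
    root_insertion a t (Node l a r).

(* [insertion s tl tr]: inserting the letters of [s] from left to right in the
   pair of empty trees produces the labeled pair [(tl, tr)]. *)
Inductive insertion : seq nat -> bintree nat -> bintree nat -> Prop :=
| InsertionNil : insertion [::] Leaf Leaf
| InsertionRcons (s : seq nat) (a : nat) (tl tr tr' : bintree nat) :
    insertion s tl tr -> root_insertion a tr tr' ->
    insertion (rcons s a) (leaf_insert a tl) tr'.

(* The graph of the map P: [is_P_symbol s J] means P(s) = J. *)
Definition is_P_symbol (s : seq nat) (J : bintree unit * bintree unit) : Prop :=
  exists tl tr, insertion s tl tr /\ J = (shape tl, shape tr).

Definition TBT_le (n : nat) (J0 J1 : TBT n) : Prop :=
  exists s0 s1 : seq nat,
    [/\ is_perm_word n s0, is_perm_word n s1,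
        is_P_symbol s0 (val J0), is_P_symbol s1 (val J1)
      & permutohedron_le s0 s1].

(* T carries a MathComp lattice structure whose order relation is [le]; in
   particular [le] is a partial order. *)
Definition is_lattice (T : Type) (le : T -> T -> Prop) : Prop :=
  exists (disp : Order.disp_t) (c : Order.Lattice disp T),
    forall x y : T, le x y <-> @Order.le disp (Order.Lattice.Pack c) x y.

(* Main.v *)
From HB Require Import structures.
From Stdlib Require Import Relation_Operators.
From mathcomp Require Import all_boot all_order.
From mathcomp Require Import boolp.
From mathcomp Require Import zify.
Require Import Defs.

Set Implicit Arguments.
Unset Strict Implicit.
Unset Printing Implicit Defensive.

(** Let [(T_L, T_R)] be the pair of labeled trees built from a word.  A node
    [x] is an ancestor of [y] in [T_L] exactly when [x] comes first in the word
    among the letters whose value lies between [x] and [y], and in [T_R] exactly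
    when it comes last ([is_ancestor_bst_of]).  So a pair of trees forces some
    inversions upon all the words that it comes from: [a < b] must be inverted
    as soon as [b] is above [a] in [T_L] or [a] is above [b] in [T_R].  The set
    of forced inversions grows when the word goes up in the permutohedron
    ([forced_word_mono]).

    The key point is that the forced inversions of a pair [J] of twin trees
    generate the inversion set of a word with P-symbol [J]
    ([exists_least_word]).  A set of pairs is an inversion set as soon as both
    it and its complement are transitive ([perm_of_inversions]); for the
    complement of the transitive closure this follows from the fact that a
    subtree of a binary search tree is an interval of labels.  The word so
    obtained is compatible with both trees because a chain of forced inversions
    from [a] to [b] cannot contradict them: if [a] were above [b] in [T_L], the
    first pair of the chain could only be forced by [T_R], hence [a] would be
    above [a + 1] in both trees, whereas the canopies of twin trees differ
    between [a] and [a + 1] ([forced_inv_acyclic]).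

    Every [J] thus has a least word, and [J <= K] holds if and only if the
    inversions of the least word of [J] are inversions of any given word of [K]
    ([TBT_le_of_sub_inversions] and [TBT_le_sub_inversions]).  This makes the
    relation a partial order.  The inversions of the least words of [J] and [K]
    generate again an inversion set, and its word has the join of [J] and [K]
    as P-symbol.  Meets come from joins, since reversing words exchanges the two
    trees and reverses the order. *)

(** * Relative order of letters in a word *)

Definition before (s : seq nat) (x y : nat) : bool := subseq [:: x; y] s.

Lemma before_index s x y :
  uniq s -> before s x y = (y \in s) && (index x s < index y s).
Proof.
rewrite /before; elim: s => [//|z s IHs] /= /andP[zs /IHs {}IHs].
rewrite in_cons ![_ == z]eq_sym.
case: (eqVneq z x) => [_|zx].
  rewrite sub1seq; case: (eqVneq z y) => [<-|_] /=; last by rewrite andbT.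
  by rewrite (negbTE zs).
by rewrite IHs; case: (eqVneq z y) => [<-|_] //=; rewrite (negbTE zs).
Qed.

Lemma before_mem s x y : before s x y -> (x \in s) && (y \in s).
Proof. by move/mem_subseq => sub; rewrite !sub ?inE ?eqxx ?orbT. Qed.

Lemma before_filter p s x y :
  before (filter p s) x y = [&& p x, p y & before s x y].
Proof. by rewrite /before subseq_filter /= andbT -andbA. Qed.

Lemma before_rev s x y : before (rev s) x y = before s y x.
Proof. by rewrite /before -(subseq_rev [:: y; x]). Qed.

Lemma before_cons s x y z :
  x != z -> before (z :: s) x y = before s x y.
Proof. by rewrite /before /= => /negbTE->. Qed.

Lemma before_head s x y : before (x :: s) x y = (y \in s).
Proof. by rewrite /before /= eqxx sub1seq. Qed.

Lemma before_neq s x y : uniq s -> before s x y -> x != y.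
Proof.
by move=> us; rewrite before_index // => /andP[_]; case: eqVneq => // ->; rewrite ltnn.
Qed.

Lemma before_asym s x y : uniq s -> before s x y -> ~~ before s y x.
Proof.
move=> us; rewrite !before_index // => /andP[_ lxy].
by rewrite negb_and -leqNgt (ltnW lxy) orbT.
Qed.

Lemma before_total s x y :
  x \in s -> y \in s -> x != y -> before s x y || before s y x.
Proof.
rewrite /before; elim: s => //= z s IHs; rewrite !in_cons !(eq_sym _ z).
case: (eqVneq z x) => [zx|zx] /=; case: (eqVneq z y) => [zy|zy] //=.
- by rewrite -zx -zy eqxx.
- by rewrite sub1seq => _ ->.
- by rewrite sub1seq => ->; rewrite orbT.
Qed.

Lemma before_trans s : uniq s -> transitive (before s).
Proof.
move=> us y x z; rewrite !before_index // => /andP[_ lxy] /andP[-> lyz].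
exact: ltn_trans lyz.
Qed.

Lemma beforeN s x y : uniq s -> x \in s -> y \in s -> x != y ->
  before s x y = ~~ before s y x.
Proof.
move=> us xs ys xy; apply/idP/idP => [|nyx]; first exact: before_asym.
by have := before_total xs ys xy; rewrite (negbTE nyx) orbF.
Qed.

(** * Binary search trees built by leaf insertion *)

Lemma sorted_labels_node l x r : sorted ltn (labels (Node l x r)) =
  [&& all (fun y => y < x) (labels l), all (fun y => x < y) (labels r),
      sorted ltn (labels l) & sorted ltn (labels r)].
Proof.
rewrite !(sorted_pairwise ltn_trans) /= pairwise_cat allrel_consr /= -!andbA.
case xl : (all _ (labels l)) => //=; case xr : (all _ (labels r)) => /=; last first.
  by rewrite !andbF.
suff -> : allrel ltn (labels l) (labels r) by [].
apply/allrelP => y z /(allP xl) yx /(allP xr); exact: ltn_trans.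
Qed.

(** [is_bst] allows equal labels on the left, which only matters when labels
    are repeated. *)
Lemma is_bstE t : uniq (labels t) -> is_bst t = sorted ltn (labels t).
Proof.
elim: t => // l IHl x r IHr; rewrite sorted_labels_node /=.
rewrite cat_uniq /= negb_or => /and4P[/IHl-> /andP[xl _] xr /IHr->].
congr (_ && _); apply: eq_in_all => y yl; rewrite leq_eqVlt.
by case: eqVneq => // yx; rewrite -yx yl in xl.
Qed.

Definition bst_of (s : seq nat) : bintree nat :=
  foldl (fun t a => leaf_insert a t) Leaf s.

Lemma bst_of_rcons s a : bst_of (rcons s a) = leaf_insert a (bst_of s).
Proof. exact: foldl_rcons. Qed.

(** The first letter stays at the root and separates the small letters from the
    large ones, so the recursion may be run from the front of the word. *)
Lemma bst_of_cons x s : bst_of (x :: s) =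
  Node (bst_of [seq y <- s | y < x]) x (bst_of [seq y <- s | x <= y]).
Proof.
rewrite /bst_of /=; elim: s (@Leaf nat) {1 3}Leaf => //= y s IHs l r.
by case: ltnP => _; rewrite IHs.
Qed.

Lemma perm_labels_leaf_insert a t :
  perm_eq (labels (leaf_insert a t)) (a :: labels t).
Proof.
elim: t => //= l IHl x r IHr; case: ifP => _ /=.
  by rewrite -cat_cons perm_cat2r.
apply/permP => p; move/permP/(_ p): IHr; rewrite /= !count_cat /=; lia.
Qed.

Lemma perm_labels_bst_of s : perm_eq (labels (bst_of s)) s.
Proof.
elim/last_ind: s => // s a IHs; rewrite bst_of_rcons perm_sym perm_rcons perm_sym.
by apply: perm_trans (perm_labels_leaf_insert _ _) _; rewrite perm_cons.
Qed.

Lemma sorted_labels_bst_of s : uniq s -> sorted ltn (labels (bst_of s)).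
Proof.
have [m] := ubnP (size s); elim: m s => // m IHm [//|x s] /= sm /andP[xs us].
rewrite bst_of_cons sorted_labels_node !IHm ?filter_uniq //; last 2 first.
- by rewrite size_filter (leq_ltn_trans (count_size _ _)).
- by rewrite size_filter (leq_ltn_trans (count_size _ _)).
rewrite !(perm_all _ (perm_labels_bst_of _)) filter_all /= andbT.
apply/allP => y; rewrite mem_filter ltn_neqAle => /andP[-> ys].
by rewrite andbT; apply: contraNneq xs => ->.
Qed.

Lemma is_ancestor_labels t x y :
  is_ancestor t x y -> (x \in labels t) && (y \in labels t).
Proof.
elim: t => //= l IHl z r IHr; rewrite !mem_cat !in_cons.
case/or3P => [/andP[/eqP-> /orP[]->]|/IHl/andP[-> ->]|/IHr/andP[-> ->]];
  by rewrite ?eqxx ?orbT.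
Qed.

(** The root of [u] is above all the other labels, so it must be the first
    letter of [s]; the two subtrees are then handled by induction.  Thus the
    order constraints carried by a binary search tree determine it, whichever
    compatible word is inserted. *)
Lemma eq_bst_of u s : uniq s -> sorted ltn (labels u) -> perm_eq (labels u) s ->
  (forall x y, is_ancestor u x y -> before s x y) -> u = bst_of s.
Proof.
elim: u s => [|l IHl x r IHr] s us; first by rewrite perm_sym => _ /perm_nilP->.
rewrite sorted_labels_node => /and4P[lx xr sl sr] lrs anc.
have mem_s := perm_mem lrs.
case: s => [|z s] in us lrs anc mem_s *.
  by have := mem_s x; rewrite /= mem_cat inE eqxx orbT.
move: us => /= /andP[zs us].
have zx : z = x.
  apply/eqP/idPn => zx; have := mem_s z; rewrite /= mem_cat !in_cons eqxx /=.
  rewrite (negbTE zx) /= => zlr.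
  have := anc x z; rewrite /= eqxx zlr => /(_ isT) /before_asym.
  rewrite /= zs us => /(_ isT); rewrite before_head.
  by have := mem_s x; rewrite /= mem_cat !in_cons eqxx orbT eq_sym (negbTE zx) /= => <-.
rewrite {z}zx in zs lrs anc mem_s *.
have {}lrs : perm_eq (labels l ++ labels r) s.
  apply/permP => p; move/permP/(_ p): lrs; rewrite /= !count_cat /=; lia.
have side (p : pred nat) t : (forall y, y \in labels t -> p y && (y != x)) ->
    (forall y z, is_ancestor t y z -> is_ancestor (Node l x r) y z) ->
    forall y z, is_ancestor t y z -> before (filter p s) y z.
  move=> pt sub y z tyz; have /andP[yt zt] := is_ancestor_labels tyz.
  have /andP[py yx] := pt y yt; have /andP[pz _] := pt z zt.
  by rewrite before_filter py pz -(@before_cons _ _ _ x) // anc ?sub.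
have flt (p : pred nat) (t t' : seq nat) :
    all p t -> all (predC p) t' -> filter p (t ++ t') = t.
  move=> pt pt'; rewrite filter_cat (all_filterP pt).
  suff /eqP-> : filter p t' == [::] by rewrite cats0.
  by by rewrite -size_eq0 size_filter eqn0Ngt -has_count -all_predC.
rewrite bst_of_cons; congr Node.
- apply: IHl; rewrite ?filter_uniq //.
    rewrite -[X in perm_eq X _](@flt (fun y => y < x) _ (labels r)) ?perm_filter //.
    by apply: sub_all xr => y /= /ltnW; rewrite leqNgt.
  apply: side => [y /(allP lx) yx|y z yz]; first by rewrite yx (ltn_eqF yx).
  by rewrite /= yz orbT.
- apply: IHr; rewrite ?filter_uniq //.
    rewrite perm_catC in lrs.
    rewrite -[X in perm_eq X _](@flt (fun y => x <= y) _ (labels l)) ?perm_filter //.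
      by apply: sub_all xr => y /= /ltnW.
    by apply: sub_all lx => y /=; rewrite -ltnNge.
  apply: side => [y /(allP xr) xy|y z yz].
    by rewrite ltnW //= neq_ltn xy orbT.
  by rewrite /= yz !orbT.
Qed.

(** * Ancestors as first letters of intervals *)

Definition between (x y z : nat) : bool := minn x y < z < maxn x y.

Lemma between_lt x y z w : x < w -> y < w -> between x y z -> z < w.
Proof. rewrite /between; lia. Qed.

Lemma between_gt x y z w : w < x -> w < y -> between x y z -> w < z.
Proof. rewrite /between; lia. Qed.

Lemma between_lt_mid x y z : x < z < y -> between x y z.
Proof. rewrite /between; lia. Qed.

Lemma between_gt_mid x y z : y < z < x -> between x y z.
Proof. rewrite /between; lia. Qed.

Lemma between_neq x y z : between x y z -> z != x.
Proof. rewrite /between; lia. Qed.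

(** Both sides are decided by the first letter of the word whose value lies in
    the closed interval with ends [x] and [y]: the letters before it send [x]
    and [y] to the same side. *)
Lemma is_ancestor_bst_of s x y : uniq s ->
  is_ancestor (bst_of s) x y <->
  before s x y /\ (forall z, between x y z -> z \in s -> before s x z).
Proof.
have [m] := ubnP (size s); elim: m s => // m IHm [|w s]; first by split=> // -[].
move=> /= sm /andP[ws us]; rewrite bst_of_cons /= !(perm_mem (perm_labels_bst_of _)).
rewrite !mem_filter -andb_orl.
have -> : (y < w) || (w <= y) by case: ltnP.
have IH t : size t <= size s -> uniq t ->
    is_ancestor (bst_of t) x y <->
    before t x y /\ (forall z, between x y z -> z \in t -> before t x z).
  by move=> ts ut; apply: IHm => //; apply: leq_ltn_trans ts _.
have {IH} IHf p : is_ancestor (bst_of (filter p s)) x y <->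
    [/\ p x, p y, before s x y &
        forall z, between x y z -> z \in s -> p z -> before s x z].
  rewrite IH ?filter_uniq ?size_filter ?count_size // before_filter.
  split=> [[/and3P[px py bxy] bz]|[px py bxy bz]].
    split=> // z xyz zs pz; have := bz z xyz; rewrite before_filter mem_filter.
    by rewrite pz zs px /= => ->.
  rewrite px py bxy; split=> // z xyz; rewrite mem_filter before_filter => /andP[pz zs].
  by rewrite px pz bz.
case: (eqVneq x w) => [xw|xw]; first rewrite -{w}xw in ws *.
  rewrite before_head /=; split=> [|[-> //]].
  case/or3P => [ys|/IHf[]|/IHf[]]; last 2 first.
  - by rewrite ltnn.
  - by move=> _ _ /before_mem/andP[xs]; rewrite xs in ws.
  split=> // z; rewrite in_cons before_head => xyz /predU1P[zx|//].
  by have := between_neq xyz; rewrite zx eqxx.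
have bw v : before (w :: s) x v = before s x v by rewrite before_cons.
rewrite /= bw; split=> [anc|[bxy bz]].
  have [px bxy bz] : [/\ (x < w) = (y < w), before s x y &
      forall z, between x y z -> z \in s -> before s x z].
    case/orP: anc => /IHf[px py bxy bz]; split=> //.
    - by rewrite px py.
    - by move=> z xyz zs; apply: bz => //; move: xyz; rewrite /between; lia.
    - by rewrite !ltnNge px py.
    - by move=> z xyz zs; apply: bz => //; move: xyz; rewrite /between; lia.
  split=> // z xyz; rewrite bw in_cons => /predU1P[zw|]; last exact: bz.
  by move: xyz xw; rewrite /between zw; lia.
have /andP[xs ys] := before_mem bxy.
have yw : y != w by apply: contraNneq ws => <-.
have wbw : ~~ between x y w.
  apply/negP => /bz; rewrite in_cons eqxx => /(_ isT) bxw.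
  by rewrite bw in bxw; case/before_mem/andP: bxw => _; apply/negP.
have bz' z : between x y z -> z \in s -> before s x z.
  by move=> /bz; rewrite in_cons bw => bz' zs; rewrite bz' // zs orbT.
have [xw'|wx] := ltnP x w; apply/orP; [left|right]; apply/IHf; split=> // [|z xyz zs _];
  try exact: bz'; by move: wbw yw xw; rewrite /between; lia.
Qed.

Lemma is_ancestor_asym t x y :
  uniq (labels t) -> is_ancestor t x y -> ~~ is_ancestor t y x.
Proof.
elim: t => //= l IHl w r IHr.
rewrite cat_uniq /= negb_or => /and4P[ul /andP[wl lr] wr ur].
have anc_l u v : is_ancestor l u v -> (v != w) && ~~ is_ancestor r v u.
  case/is_ancestor_labels/andP => ul' vl; apply/andP; split.
    by apply: contraNneq wl => <-.
  apply: contraNN lr => /is_ancestor_labels/andP[_ ur'].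
  by apply/hasP; exists u.
have anc_r u v : is_ancestor r u v -> (v != w) && ~~ is_ancestor l v u.
  case/is_ancestor_labels/andP => ur' vr; apply/andP; split.
    by apply: contraNneq wr => <-.
  apply: contraNN lr => /is_ancestor_labels/andP[_ ul'].
  by apply/hasP; exists u.
case/or3P => [/andP[/eqP-> ylr]|xy|xy]; rewrite !negb_or.
- have yw : y != w by apply: contraTneq ylr => ->; rewrite negb_or wl.
  rewrite (negbTE yw) /=; apply/andP; split; apply/negP.
    by move=> /anc_l; rewrite eqxx.
  by move=> /anc_r; rewrite eqxx.
- by have /andP[yw ryx] := anc_l _ _ xy; rewrite (negbTE yw) IHl.
- by have /andP[yw lyx] := anc_r _ _ xy; rewrite (negbTE yw) IHr //= andbT.
Qed.

Lemma is_ancestor_neq t x y :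
  uniq (labels t) -> is_ancestor t x y -> x != y.
Proof.
by move=> ut xy; apply: contraTneq (xy) => e; move: (is_ancestor_asym ut xy); rewrite e.
Qed.

(** A subtree occupies consecutive labels in inorder. *)
Lemma is_ancestor_convex t x y z : sorted ltn (labels t) ->
  is_ancestor t x y -> between x y z -> z \in labels t -> is_ancestor t x z.
Proof.
elim: t => // l IHl w r IHr; rewrite sorted_labels_node.
case/and4P => /allP lw /allP wr sl sr; rewrite /= mem_cat in_cons.
case/or3P => [/andP[/eqP-> _]|xy|xy] xyz.
- by rewrite eqxx (negbTE (between_neq xyz)) /= => ->.
- have /andP[/lw xw /lw yw] := is_ancestor_labels xy.
  have zw := between_lt xw yw xyz; rewrite (ltn_eqF zw).
  case/orP => [zl|/wr]; first by rewrite (IHl sl xy) // orbT.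
  by rewrite /= ltnNge (ltnW zw).
- have /andP[/wr xw /wr yw] := is_ancestor_labels xy.
  have zw := between_gt xw yw xyz; rewrite (gtn_eqF zw).
  case/orP => [/lw|zr]; last by rewrite (IHr sr xy) // !orbT.
  by rewrite /= ltnNge (ltnW zw).
Qed.

(** * The P-symbol as a function *)

(** Restricting to an interval of values amounts to erasing letters of the word.
    Convexity of [p] means that no letter between two kept ones is erased, so
    that the ancestors in the new tree are ancestors in the old one; [eq_bst_of]
    shows that no other tree qualifies. *)
Lemma is_restriction_bst_of (p : pred nat) s u : uniq s ->
  (forall x y z, p x -> p y -> between x y z -> p z) ->
  is_restriction p (bst_of s) u <-> u = bst_of (filter p s).
Proof.
move=> us convex; have ups := filter_uniq p us.
have labels_p := perm_filter p (perm_labels_bst_of s).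
split=> [[bst_u lab_u anc]|->].
  have {}lab_u := perm_trans lab_u labels_p.
  have uu : uniq (labels u) by rewrite (perm_uniq lab_u).
  apply: eq_bst_of => // [|x y xy]; first by rewrite -is_bstE.
  have [bxy _] := (is_ancestor_bst_of x y us).1 (anc x y xy).
  move: (is_ancestor_labels xy); rewrite !(perm_mem lab_u) !mem_filter before_filter.
  by case/andP => /andP[-> _] /andP[-> _].
have uu : uniq (labels (bst_of (filter p s))) by rewrite (perm_uniq (perm_labels_bst_of _)).
split; first by rewrite is_bstE // sorted_labels_bst_of.
  by rewrite perm_sym in labels_p; apply: perm_trans labels_p; apply: perm_labels_bst_of.
move=> x y /(is_ancestor_bst_of x y ups)[]; rewrite before_filter => /and3P[px py bxy] bz.
apply/(is_ancestor_bst_of x y us); split=> // z xyz zs.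
have pz := convex _ _ _ px py xyz.
by have := bz z xyz; rewrite mem_filter before_filter pz zs px => /(_ isT).
Qed.

(** Root insertion at the end of a word is leaf insertion at its front; this is
    why the right tree is the binary search tree of the reversed word. *)
Lemma root_insertion_bst_of a s t : uniq (a :: s) ->
  root_insertion a (bst_of s) t <-> t = bst_of (a :: s).
Proof.
move=> /= /andP[sa us]; rewrite bst_of_cons.
have low : [seq x <- s | x <= a] = [seq x <- s | x < a].
  apply: eq_in_filter => x xs; rewrite ltn_neqAle.
  by case: eqVneq => // xa; rewrite -xa xs in sa.
have high : [seq x <- s | a < x] = [seq x <- s | a <= x].
  apply: eq_in_filter => x xs; rewrite ltn_neqAle eq_sym.
  by case: eqVneq => // xa; rewrite -xa xs in sa.
have cl x y z : x <= a -> y <= a -> between x y z -> z <= a by rewrite /between; lia.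
have cr x y z : a < x -> a < y -> between x y z -> a < z by rewrite /between; lia.
rewrite -low -high; split=> [[l r]|->].
  by move=> /(is_restriction_bst_of _ us cl)-> /(is_restriction_bst_of _ us cr)->.
by constructor; apply/is_restriction_bst_of.
Qed.

Lemma insertion_bst_of s tl tr : uniq s ->
  insertion s tl tr <-> tl = bst_of s /\ tr = bst_of (rev s).
Proof.
move=> us; split=> [ins|[-> ->]].
  elim: ins us => // {tl tr}s a tl tr tr' _ IHs root.
  rewrite -rev_uniq rev_rcons bst_of_rcons => us.
  have := us; rewrite /= rev_uniq => /andP[_ /IHs[-> e]]; rewrite e in root.
  by split=> //; apply/root_insertion_bst_of.
elim/last_ind: s us => [|s a IHs] us; first exact: InsertionNil.
rewrite bst_of_rcons rev_rcons; apply: (InsertionRcons (tr := bst_of (rev s))).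
  by apply: IHs; move: us; rewrite rcons_uniq => /andP[].
by apply/root_insertion_bst_of; rewrite // -rev_rcons rev_uniq.
Qed.

Definition P_symbol (s : seq nat) : bintree unit * bintree unit :=
  (shape (bst_of s), shape (bst_of (rev s))).

Lemma is_P_symbolE s J : uniq s -> is_P_symbol s J <-> J = P_symbol s.
Proof.
move=> us; split=> [[tl [tr [/(insertion_bst_of _ _ us)[-> ->] ->]]]|->] //.
by exists (bst_of s), (bst_of (rev s)); split=> //; apply/insertion_bst_of.
Qed.

(** * The permutohedron order through inversions *)

Definition is_inversion (s : seq nat) (a b : nat) : bool := (a < b) && before s b a.

Lemma permutohedron_le_perm s t : permutohedron_le s t -> perm_eq s t.
Proof.
elim=> {s t}[_ _ [u v a b _]|//|s t r _ pst _]; last exact: perm_trans.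
by apply/permP => p; rewrite !count_cat /=; lia.
Qed.

Lemma permutohedron_le_sub_inversions s t a b :
  permutohedron_le s t -> is_inversion s a b -> is_inversion t a b.
Proof.
elim=> {s t}[_ _ [u v c d cd]|//|s t r _ st _ tr /st/tr//].
case/andP => ab; rewrite /is_inversion ab /=; elim: u => [|e u IHu] /=; last first.
  have [->|be] := eqVneq b e; last by rewrite !before_cons.
  by rewrite !before_head !mem_cat !in_cons (orbCA (a == c)).
have [bc|bc] := eqVneq b c.
  rewrite bc before_head in_cons before_cons ?before_head; last by rewrite ltn_eqF.
  by case/predU1P => // ad; move: ab; rewrite ad bc ltnNge ltnW.
rewrite before_cons //; have [->|bd] := eqVneq b d.
  by rewrite !before_head in_cons orbC => ->.
by rewrite !before_cons.
Qed.

Lemma permutohedron_le_cons x s t :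
  permutohedron_le s t -> permutohedron_le (x :: s) (x :: t).
Proof.
elim=> {s t}[_ _ [u v a b ab]|s|s t r _ st _ tr].
- by apply: rt_step; apply: (PermutohedronCover (x :: u)).
- exact: rt_refl.
- exact: rt_trans st tr.
Qed.

Lemma permutohedron_le_rev s t :
  permutohedron_le s t -> permutohedron_le (rev t) (rev s).
Proof.
elim=> {s t}[_ _ [u v a b ab]|s|s t r _ st _ tr].
- apply: rt_step; rewrite !rev_cat !rev_cons -!cats1 -!catA.
  exact: PermutohedronCover.
- exact: rt_refl.
- exact: rt_trans tr st.
Qed.

Lemma permutohedron_le_front x u v : all (fun y => y < x) u ->
  permutohedron_le (u ++ x :: v) (x :: u ++ v).
Proof.
elim/last_ind: u v => [|u y IHu] v; first by move=> _; apply: rt_refl.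
rewrite all_rcons => /andP[yx ux]; rewrite !cat_rcons.
apply: rt_trans (IHu _ ux); apply: rt_step; exact: PermutohedronCover.
Qed.

(** In [s], only smaller letters may precede the first letter [x] of [t], since
    the pairs formed by [x] and larger letters are not inverted in [t].  Moving
    [x] to the front therefore goes up, and the two tails are compared by
    induction. *)
Lemma sub_inversions_permutohedron_le s t : uniq s -> perm_eq s t ->
  (forall a b, is_inversion s a b -> is_inversion t a b) -> permutohedron_le s t.
Proof.
elim: t s => [|x t IHt] s us; first by move=> /perm_nilP-> _; apply: rt_refl.
move=> st sub; have ut := us; rewrite (perm_uniq st) /= in ut.
have /andP[xt {}ut] := ut.
have xs : x \in s by rewrite (perm_mem st) in_cons eqxx.
case/splitPr: xs => u v in us st sub *.
have uvx : x \notin u ++ v.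
  by move: us; rewrite uniq_catC cat_cons /= mem_cat orbC -mem_cat => /andP[].
have uuv : uniq (u ++ v).
  by move: us; rewrite uniq_catC cat_cons /= uniq_catC => /andP[].
have st' : perm_eq (u ++ v) t.
  by apply/permP => p; move/permP/(_ p): st; rewrite !count_cat /=; lia.
have ux : all (fun y => y < x) u.
  apply/allP => y yu; rewrite ltnNge leq_eqVlt; apply/negP.
  case/predU1P => [xy|xy]; first by move: uvx; rewrite mem_cat xy yu.
  have bs : before (u ++ x :: v) y x.
    by rewrite /before -cat1s cat_subseq // sub1seq ?in_cons ?eqxx.
  have /andP[_] : is_inversion (x :: t) x y by apply: sub; rewrite /is_inversion xy.
  by apply/negP/before_asym; rewrite //= ?xt // before_head -(perm_mem st') mem_cat yu.
apply: rt_trans (permutohedron_le_front v ux) _; apply: permutohedron_le_cons.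
apply: IHt => // a b /andP[ab bab]; have /andP[bu au] := before_mem bab.
have /sub : is_inversion (u ++ x :: v) a b.
  rewrite /is_inversion ab; apply: subseq_trans bab _; apply: cat_subseq => //.
  exact: subseq_cons.
by rewrite /is_inversion before_cons //; apply: contraNneq uvx => <-.
Qed.

Lemma clos_trans_closed (G R : nat -> nat -> Prop) :
  (forall a b, G a b -> R a b) ->
  (forall a b c, R a b -> R b c -> R a c) ->
  forall a b, clos_trans nat G a b -> R a b.
Proof. by move=> GR tR a b; elim=> // x y z _ Rxy _; apply: tR. Qed.

(** On the pairs [a < b] this says that the complement is transitive. *)
Definition cotransitive (G : nat -> nat -> Prop) : Prop :=
  forall a b c, a < b < c -> G a c -> G a b \/ G b c.

(** An intermediate value [b] either is a vertex of the chain from [a] to [c] or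
    falls inside one of its steps, which [G] then allows to split. *)
Lemma clos_trans_cotransitive G :
  cotransitive G -> cotransitive (clos_trans nat G).
Proof.
move=> coG a b c abc Gac; elim: Gac b abc => {a c}[a c Gac|a x c ax IHa xc IHc] b abc.
  by have [G1|G2] := coG _ _ _ abc Gac; [left|right]; apply: t_step.
have [bx|xb|bx] := ltngtP b x; last by rewrite bx; left.
- have [|Gab|Gbx] := IHa b; first by case/andP: abc => ->.
    by left.
  by right; apply: t_trans xc.
- have [|Gxb|Gbc] := IHc b; first by case/andP: abc => _ ->; rewrite xb.
    by left; apply: t_trans Gxb.
  by right.
Qed.

Lemma is_perm_word_uniq n s : is_perm_word n s -> uniq s.
Proof. by move/perm_uniq->; apply: iota_uniq. Qed.

Lemma is_perm_word_mem n s x : is_perm_word n s -> (x \in s) = (0 < x <= n).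
Proof. by move/perm_mem->; rewrite mem_iota add1n ltnS. Qed.

Lemma is_perm_word_rev n s : is_perm_word n (rev s) = is_perm_word n s.
Proof. by rewrite /is_perm_word perm_rev. Qed.

Lemma is_inversion_cotransitive n s :
  is_perm_word n s -> cotransitive (is_inversion s).
Proof.
move=> ps a b c /andP[ab bc] /andP[ac bca]; rewrite /is_inversion ab bc /=.
have us := is_perm_word_uniq ps; have /andP[cs as_] := before_mem bca.
have bs : b \in s.
  by move: cs as_; rewrite !(is_perm_word_mem _ ps); lia.
have [] := orP (before_total as_ bs _); [by rewrite ltn_eqF| |by left].
by move=> bab; right; apply: before_trans bab.
Qed.

Lemma is_inversion_trans s a b c : uniq s ->
  is_inversion s a b -> is_inversion s b c -> is_inversion s a c.
Proof.
move=> us /andP[ab bba] /andP[bc bcb]; rewrite /is_inversion (ltn_trans ab bc) /=.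
exact: before_trans bba.
Qed.

(** The word is the sorted list of letters for the relation that reverses the
    natural order exactly on the pairs of the closure; cotransitivity is what
    makes this relation transitive. *)
Lemma perm_of_inversions n G :
  (forall a b, G a b -> 0 < a /\ a < b <= n) -> cotransitive G ->
  exists2 s, is_perm_word n s &
    forall a b, is_inversion s a b <-> clos_trans nat G a b.
Proof.
move=> G_lt coG; pose R := clos_trans nat G.
have R_lt a b : R a b -> 0 < a /\ a < b <= n.
  apply: (clos_trans_closed G_lt) => {}a {}b c; lia.
have coR : cotransitive R := clos_trans_cotransitive coG.
pose leR x y := if x < y then ~~ `[< R x y >] else (y < x) ==> `[< R y x >].
have leR_total : total leR.
  move=> x y; rewrite /leR; case: (ltngtP x y) => //= _; first exact: orNb.
  exact: orbN.
have leR_trans : transitive leR.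
  move=> y x z; rewrite /leR.
  have tr a b c : R a b -> R b c -> R a c by move=> *; apply: t_trans; eassumption.
  case: (ltngtP x y) => [xy|yx|->] //; case: (ltngtP y z) => [yz|zy|<-] //=.
  - move=> /asboolPn nxy /asboolPn nyz; rewrite (ltn_trans xy yz).
    by apply/asboolPn => /(coR x y z); rewrite xy yz => /(_ isT)[].
  - move=> /asboolPn nxy /asboolP Rzy.
    case: (ltngtP x z) => [xz|zx|//] /=.
      by apply/asboolPn => Rxz; apply: nxy; apply: tr Rzy.
    by apply/asboolP; case: (coR z x y _ Rzy) => //; rewrite zx xy.
  - by rewrite xy.
  - move=> /asboolP Ryx /asboolPn nyz.
    case: (ltngtP x z) => [xz|zx|//] /=.
      by apply/asboolPn => Rxz; apply: nyz; apply: tr Rxz.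
    by apply/asboolP; case: (coR y z x _ Ryx) => //; rewrite yz zx.
  - move=> /asboolP Ryx /asboolP Rzy.
    rewrite ltnNge ltnW ?(ltn_trans zy yx) //=; apply/asboolP; exact: tr Ryx.
  - by move=> Ryx _; rewrite ltnNge ltnW ?yx.
pose s := sort leR (iota 1 n).
have ps : is_perm_word n s by rewrite /is_perm_word perm_sort.
have us := is_perm_word_uniq ps.
have srt : sorted leR s by apply: sort_sorted.
exists s => // a b; have bef x y : before s x y -> leR x y.
  by move=> /(subseq_sorted leR_trans)/(_ srt) /=; rewrite andbT.
split=> [/andP[ab /bef]|Rab].
  by rewrite /leR ab ltnNge (ltnW ab) /= => /asboolP.
have [a0 /andP[ab bn]] := R_lt _ _ Rab; rewrite /is_inversion ab /=.
have as_ : a \in s by rewrite (is_perm_word_mem _ ps) a0 (leq_trans (ltnW ab)).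
have bs : b \in s by rewrite (is_perm_word_mem _ ps) bn (ltn_trans a0).
have [] := orP (before_total as_ bs _); [by rewrite ltn_eqF| |by []].
by move=> /bef; rewrite /leR ab => /asboolPn.
Qed.

(** * Canopies and twin trees *)

Fixpoint inorder_label (k : nat) (t : bintree unit) : bintree nat :=
  if t is Node l _ r then
    Node (inorder_label k l) (k + nb_nodes l)
         (inorder_label (k + nb_nodes l).+1 r)
  else Leaf.

Lemma shape_inorder_label k t : shape (inorder_label k t) = t.
Proof. by elim: t k => //= l IHl [] r IHr k; rewrite IHl IHr. Qed.

Lemma labels_inorder_label k t :
  labels (inorder_label k t) = iota k (nb_nodes t).
Proof.
elim: t k => // l IHl x r IHr k.
have -> : nb_nodes (Node l x r) = nb_nodes l + (nb_nodes r).+1 by rewrite addnS.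
by rewrite iotaD /= IHl IHr.
Qed.

Lemma size_labels A (t : bintree A) : size (labels t) = nb_nodes t.
Proof. by elim: t => //= l IHl x r IHr; rewrite size_cat /= IHl IHr addnS. Qed.

Lemma labels_nil A (t : bintree A) : labels t = [::] -> t = Leaf.
Proof. by case: t => //= l x r; case: (labels l). Qed.

Lemma nb_nodes_shape A (t : bintree A) : nb_nodes (shape t) = nb_nodes t.
Proof. by elim: t => //= l -> x r ->. Qed.

Lemma eq_shape_labels A (t u : bintree A) :
  shape t = shape u -> labels t = labels u -> t = u.
Proof.
elim: t u => [|l IHl x r IHr] [|l' x' r'] //= [ll' rr'].
have sl : size (labels l) = size (labels l').
  by rewrite !size_labels -(nb_nodes_shape l) ll' nb_nodes_shape.
move=> e; have := congr1 (take (size (labels l))) e.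
rewrite take_size_cat // sl take_size_cat // => el.
have := congr1 (drop (size (labels l))) e.
rewrite drop_size_cat // sl drop_size_cat // => -[-> er].
by rewrite (IHl l') // (IHr r').
Qed.

Lemma canopy_shape A (t : bintree A) : canopy (shape t) = canopy t.
Proof.
rewrite /canopy; congr omit_first_last.
by elim: t true => //= l IHl x r IHr b; rewrite IHl IHr.
Qed.

(** The leaf between the nodes [i] and [i + 1] is a left child precisely when
    [i] is above [i + 1]: it then is the leftmost leaf of the right subtree of
    [i]. *)
Lemma leaf_word_is_ancestor b t k n : labels t = iota k n.+1 ->
  leaf_word b t =
  true :: rcons [seq is_ancestor t i i.+1 | i <- iota k n] false.
Proof.
elim: t b k n => [|l IHl x r IHr] b k n lab_t //.
pose p := nb_nodes l; pose q := nb_nodes r.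
have np : n = p + q.
  by have := congr1 size lab_t; rewrite size_labels size_iota => -[].
move: lab_t; rewrite np -addnS iotaD /= => lab_t.
have := congr1 (take p) lab_t; have := congr1 (drop p) lab_t.
rewrite !take_size_cat ?drop_size_cat ?size_labels ?size_iota //.
move=> -[xE lab_r] lab_l; rewrite -xE in lab_r *.
have anc_l i j : i < x -> is_ancestor r i j = false.
  move=> ix; apply/negP => /is_ancestor_labels/andP[]; rewrite lab_r mem_iota.
  by rewrite leqNgt ltnS ltnW.
have anc_r i j : x <= i -> is_ancestor l i j = false.
  move=> ix; apply/negP => /is_ancestor_labels/andP[]; rewrite lab_l mem_iota -xE.
  by rewrite [_ < x]ltnNge ix andbF.
have -> : leaf_word true l =
    true :: [seq is_ancestor (Node l x r) i i.+1 | i <- iota k p].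
  case: p => [|p] in np lab_t xE lab_l *; first by rewrite (labels_nil lab_l).
  rewrite (IHl _ _ _ lab_l); congr cons; rewrite -[in RHS]addn1 iotaD map_cat cats1.
  congr rcons.
    apply/eq_in_map => i; rewrite mem_iota => /andP[_ ikp].
    have ix : i < x by rewrite xE addnS ltnS ltnW.
    by rewrite /= (anc_l _ _ ix) (ltn_eqF ix) orbF.
  have ix : k + p < x by rewrite xE addnS.
  rewrite /= (anc_l _ _ ix) (ltn_eqF ix) orbF; apply/esym/negP.
  by case/is_ancestor_labels/andP => _; rewrite lab_l mem_iota addnS ltnn andbF.
have -> : leaf_word false r =
    rcons [seq is_ancestor (Node l x r) i i.+1 | i <- iota x q] false.
  case: q => [|q] in np lab_t lab_r *; first by rewrite (labels_nil lab_r).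
  rewrite (IHr _ _ _ lab_r) /= eqxx lab_r in_cons eqxx !orbT; congr (_ :: rcons _ _).
  apply/eq_in_map => i; rewrite mem_iota => /andP[xi _].
  by rewrite (anc_r _ _ (ltnW xi)) (gtn_eqF xi).
by rewrite iotaD map_cat rcons_cat xE.
Qed.

Lemma canopy_is_ancestor t n : labels t = iota 1 n ->
  canopy t = [seq is_ancestor t i i.+1 | i <- iota 1 n.-1].
Proof.
case: n => [|n] lab_t; first by rewrite (labels_nil lab_t).
rewrite /canopy (leaf_word_is_ancestor _ lab_t) /omit_first_last /=.
by rewrite size_rcons size_map size_iota -cats1 take_size_cat // size_map size_iota.
Qed.

(** Twin pairs expressed on the labeled trees, through the meaning of canopy
    letters. *)
Definition twin_trees (n : nat) (tl tr : bintree nat) : Prop :=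
  [/\ labels tl = iota 1 n, labels tr = iota 1 n &
      forall i, 0 < i < n -> is_ancestor tl i i.+1 = ~~ is_ancestor tr i i.+1].

Lemma is_twin_shape n tl tr : labels tl = iota 1 n -> labels tr = iota 1 n ->
  is_twin n (shape tl, shape tr) <-> twin_trees n tl tr.
Proof.
move=> lab_l lab_r; rewrite /is_twin /= !nb_nodes_shape !canopy_shape.
rewrite -!size_labels lab_l lab_r size_iota eqxx /=.
rewrite (canopy_is_ancestor lab_l) (canopy_is_ancestor lab_r).
have canE t (i : 'I_n.-1) : nth false [seq is_ancestor t i i.+1 | i <- iota 1 n.-1] i =
    is_ancestor t i.+1 i.+2.
  by rewrite (nth_map 0) ?size_iota // nth_iota.
split=> [/forallP twin|[_ _ twin]]; last first.
  apply/forallP => i; rewrite !canE twin; first by case: is_ancestor.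
  by case: i => i /=; lia.
split=> // -[|i] // /andP[_ i_n]; have i_n1 : i < n.-1 by lia.
by have := twin (Ordinal i_n1); rewrite !canE /=; do 2!case: is_ancestor.
Qed.

Lemma labels_bst_of n s : is_perm_word n s -> labels (bst_of s) = iota 1 n.
Proof.
move=> ps; apply: (irr_sorted_eq ltn_trans ltnn); last first.
- by move=> x; rewrite (perm_mem (perm_labels_bst_of s)) (perm_mem ps).
- exact: iota_ltn_sorted.
- exact: sorted_labels_bst_of (is_perm_word_uniq ps).
Qed.

(** Both canopies compare the positions of [i] and [i + 1], one in the word and
    the other in the reversed word. *)
Lemma twin_P_symbol n s : is_perm_word n s -> is_twin n (P_symbol s).
Proof.
move=> ps; have ps' : is_perm_word n (rev s) by rewrite is_perm_word_rev.
have us := is_perm_word_uniq ps; have us' := is_perm_word_uniq ps'.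
apply/is_twin_shape; rewrite ?(labels_bst_of ps) ?(labels_bst_of ps') //.
split=> [||i i_n]; rewrite ?(labels_bst_of ps) ?(labels_bst_of ps') //.
have bw z : between i i.+1 z = false by rewrite /between; lia.
have gap w : uniq w -> is_ancestor (bst_of w) i i.+1 = before w i i.+1.
  move=> uw; apply/idP/idP => [/(is_ancestor_bst_of _ _ uw)[]//|b].
  by apply/(is_ancestor_bst_of _ _ uw); split=> // z; rewrite bw.
rewrite !gap // before_rev; apply: (beforeN us); rewrite ?(is_perm_word_mem _ ps); lia.
Qed.

(** * Forced inversions and least words *)

(** The inversions imposed on any word with trees [tl] and [tr]: the root of a
    subtree comes before its other labels for [tl], and after them for [tr]. *)
Definition forced_inv (tl tr : bintree nat) (a b : nat) : bool :=
  (a < b) && (is_ancestor tl b a || is_ancestor tr a b).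

Lemma forced_inv_cotransitive n tl tr :
  twin_trees n tl tr -> cotransitive (forced_inv tl tr).
Proof.
move=> [lab_l lab_r _] a b c /andP[ab bc]; rewrite /forced_inv ab bc /=.
have srt := iota_ltn_sorted 1 n.
have btw : between a c b && between c a b by rewrite /between; lia.
case/andP => _ /orP[] anc; have /andP[] := is_ancestor_labels anc.
- rewrite lab_l => cn an.
  have bn : b \in iota 1 n by move: an cn; rewrite !mem_iota; lia.
  by right; rewrite (is_ancestor_convex _ anc) ?lab_l //; case/andP: btw.
- rewrite lab_r => an cn.
  have bn : b \in iota 1 n by move: an cn; rewrite !mem_iota; lia.
  by left; rewrite (is_ancestor_convex _ anc) ?lab_r ?orbT //; case/andP: btw.
Qed.

(** This is where the twin condition is used.  Along a chain of forced
    inversions from [a] to [b], if [a] is above [b] in [tl] then it is above the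
    end [c] of the first step, which must therefore be forced by [tr]; so [a] is
    above [a + 1] in both trees.  The case of [tr] is symmetric, with the last
    step [(d, b)] and the labels [b - 1] and [b]. *)
Lemma forced_inv_acyclic n tl tr a b : twin_trees n tl tr ->
  clos_trans nat (forced_inv tl tr) a b ->
  ~~ is_ancestor tl a b && ~~ is_ancestor tr b a.
Proof.
move=> [lab_l lab_r twin] ab.
have srt := iota_ltn_sorted 1 n.
have [ul ur] : uniq (labels tl) /\ uniq (labels tr).
  by rewrite lab_l lab_r iota_uniq.
have [[c /andP[acb Uac]] [d /andP[adb Udb]]] :
    (exists c, (a < c <= b) && forced_inv tl tr a c) /\
    (exists c, (a <= c < b) && forced_inv tl tr c b).
  elim: ab => {a b}[a b Uab|a x b _ [[c Uac] [d Udx]] _ [[e Uxe] [f Ufb]]].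
    by case/andP: (Uab) => ab _; split; [exists b|exists a]; rewrite Uab ab leqnn.
  split; [exists c; case/andP: Uac => acx ->|exists f; case/andP: Ufb => xfb ->].
    case/andP: acx => -> cx; case/andP: Uxe => /andP[xe eb] _ /=.
    by rewrite (leq_trans cx) // (leq_trans (ltnW xe)).
  case/andP: xfb => xf ->; case/andP: Udx => /andP[ad dx] _ /=.
  by rewrite andbT (leq_trans ad) // (leq_trans (ltnW dx)).
have mem_between y : a \in iota 1 n -> b \in iota 1 n -> a <= y <= b ->
    y \in iota 1 n.
  rewrite !mem_iota => /andP[a0 _] /andP[_ bn] /andP[ay yb].
  by rewrite (leq_trans a0 ay) (leq_ltn_trans yb bn).
case/andP: acb => ac cb; case/andP: adb => ad db; have ab' := leq_trans ac cb.
apply/andP; split; apply/negP => anc.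
- have /andP[] := is_ancestor_labels anc; rewrite lab_l => an bn.
  have down t z y : labels t = iota 1 n -> z <= b -> is_ancestor t a z ->
      a < y <= z -> is_ancestor t a y.
    move=> lab_t zb tz /andP[ay]; rewrite leq_eqVlt => /predU1P[->//|yz].
    apply: (is_ancestor_convex _ tz); rewrite ?lab_t // ?between_lt_mid ?ay //.
    by apply: mem_between; rewrite ?(ltnW ay) ?(leq_trans (ltnW yz)).
  have lac : is_ancestor tl a c by apply: down anc _; rewrite ?ac.
  have rac : is_ancestor tr a c.
    by case/andP: Uac => _; rewrite (negbTE (is_ancestor_asym ul lac)).
  have := twin a; rewrite (down _ _ a.+1 lab_l cb lac) ?ltnSn //.
  rewrite (down _ _ a.+1 lab_r cb rac) ?ltnSn //.
  move: an bn; rewrite !mem_iota => /andP[-> _] /andP[_ bn] /=.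
  by rewrite (leq_trans ab') //= => /(_ isT).
- have /andP[] := is_ancestor_labels anc; rewrite lab_r => bn an.
  have down t z y : labels t = iota 1 n -> a <= z -> is_ancestor t b z ->
      z <= y < b -> is_ancestor t b y.
    move=> lab_t az tz /andP[]; rewrite leq_eqVlt => /predU1P[<-//|zy yb].
    apply: (is_ancestor_convex _ tz); rewrite ?lab_t // ?between_gt_mid ?zy //.
    by apply: mem_between; rewrite ?(ltnW yb) ?andbT ?(leq_trans az (ltnW zy)).
  have rbd : is_ancestor tr b d by apply: down anc _; rewrite ?ad.
  have lbd : is_ancestor tl b d.
    by case/andP: Udb => _; rewrite (negbTE (is_ancestor_asym ur rbd)) orbF.
  case: b {cb anc ab} => [//|b] in db ab' down mem_between bn an rbd lbd Udb *.
  have dbb : d <= b < b.+1 by rewrite -ltnS db ltnSn.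
  have /negbTE lbb := is_ancestor_asym ul (down _ _ _ lab_l ad lbd dbb).
  have /negbTE rbb := is_ancestor_asym ur (down _ _ _ lab_r ad rbd dbb).
  have := twin b; rewrite lbb rbb.
  move: an bn; rewrite !mem_iota add1n ltnS => /andP[a0 _] /andP[_ bn].
  by rewrite ltnS in bn; rewrite (leq_trans a0) // bn => /(_ isT).
Qed.

(** By [eq_bst_of], it suffices that the word generated by the forced inversions
    puts ancestors first in [tl] and last in [tr].  An ancestor pair that must be
    inverted is forced; one that must not be is not in the closure, by
    [forced_inv_acyclic]. *)
Lemma exists_least_word n tl tr : twin_trees n tl tr ->
  exists s, [/\ is_perm_word n s, bst_of s = tl, bst_of (rev s) = tr &
    forall a b, is_inversion s a b -> clos_trans nat (forced_inv tl tr) a b].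
Proof.
move=> tw; have [lab_l lab_r twin] := tw.
have srt := iota_ltn_sorted 1 n.
have forced_mem a b : forced_inv tl tr a b -> 0 < a /\ a < b <= n.
  case/andP => ab /orP[]/is_ancestor_labels/andP[]; rewrite ?lab_l ?lab_r !mem_iota; lia.
have [s ps invE] := perm_of_inversions forced_mem (forced_inv_cotransitive tw).
have us := is_perm_word_uniq ps.
exists s; split=> //; last by move=> a b /invE.
- apply/esym/eq_bst_of; rewrite ?lab_l // 1?perm_sym // => x y xy.
  have /andP[xs ys] := is_ancestor_labels xy; rewrite lab_l -!(perm_mem ps) in xs ys.
  have [ltxy|ltyx|e] := ltngtP x y; last first.
  + by have := is_ancestor_neq _ xy; rewrite lab_l iota_uniq e eqxx => /(_ isT).
  + have /invE/andP[] // : clos_trans nat (forced_inv tl tr) y x.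
    by apply: t_step; rewrite /forced_inv ltyx xy.
  rewrite (beforeN us) ?ltn_eqF //; apply/negP => yx.
  have /(forced_inv_acyclic tw) : clos_trans nat (forced_inv tl tr) x y.
    by apply/invE; rewrite /is_inversion ltxy.
  by rewrite xy.
- apply/esym/eq_bst_of; rewrite ?rev_uniq ?lab_r // 1?perm_sym ?perm_rev // => x y xy.
  rewrite before_rev.
  have /andP[xs ys] := is_ancestor_labels xy; rewrite lab_r -!(perm_mem ps) in xs ys.
  have [ltxy|ltyx|e] := ltngtP x y; last first.
  + by have := is_ancestor_neq _ xy; rewrite lab_r iota_uniq e eqxx => /(_ isT).
  + rewrite (beforeN us) ?ltn_eqF //; apply/negP => bxy.
    have /(forced_inv_acyclic tw) : clos_trans nat (forced_inv tl tr) y x.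
      by apply/invE; rewrite /is_inversion ltyx.
    by rewrite xy andbF.
  have /invE/andP[] // : clos_trans nat (forced_inv tl tr) x y.
  by apply: t_step; rewrite /forced_inv ltxy xy orbT.
Qed.

Notation forced_word s := (forced_inv (bst_of s) (bst_of (rev s))).

Lemma forced_word_is_inversion s a b :
  uniq s -> forced_word s a b -> is_inversion s a b.
Proof.
move=> us /andP[ab]; have us' : uniq (rev s) by rewrite rev_uniq.
rewrite /is_inversion ab -before_rev.
case/orP => [/(is_ancestor_bst_of _ _ us)|/(is_ancestor_bst_of _ _ us')] [] //.
by rewrite before_rev.
Qed.

(** That [b] is the first letter with value between [a] and [b], or that [a] is
    the last one, is expressed by inversions only, and never by their absence. *)
Lemma forced_word_mono s t a b : uniq s -> perm_eq s t ->
  (forall x y, is_inversion s x y -> is_inversion t x y) ->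
  forced_word s a b -> forced_word t a b.
Proof.
move=> us st sub /andP[ab anc]; rewrite /forced_inv ab /=.
have ut : uniq t by rewrite -(perm_uniq st).
have us' : uniq (rev s) by rewrite rev_uniq.
have ut' : uniq (rev t) by rewrite rev_uniq.
have bef x y : y < x -> before s x y -> before t x y.
  by move=> yx bxy; have /sub/andP[] : is_inversion s y x by rewrite /is_inversion yx.
apply/orP; case/orP: anc => anc; [left|right].
- apply/(is_ancestor_bst_of _ _ ut); case/(is_ancestor_bst_of _ _ us): anc => bba bz.
  split=> [|z baz]; first exact: bef.
  rewrite -(perm_mem st) => zs; apply: bef (bz z baz zs).
  by move: baz; rewrite /between; lia.
- apply/(is_ancestor_bst_of _ _ ut'); case/(is_ancestor_bst_of _ _ us'): anc.
  rewrite !before_rev => bba bz; split=> [|z baz]; first exact: bef.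
  rewrite mem_rev -(perm_mem st) => zs; rewrite before_rev; apply: bef.
    by move: baz; rewrite /between; lia.
  by have := bz z baz; rewrite mem_rev before_rev => /(_ zs).
Qed.

(** * The order on pairs of twin binary trees *)

Definition reading_word (n : nat) (J : TBT n) (s : seq nat) : Prop :=
  is_perm_word n s /\ val J = P_symbol s.

(** Forced inversions are inversions of every word of [J], so this states that
    [s] has the smallest possible inversion set, in a form that only depends on
    [J]. *)
Definition least_word (n : nat) (J : TBT n) (s : seq nat) : Prop :=
  reading_word J s /\
  forall a b, is_inversion s a b -> clos_trans nat (forced_word s) a b.

Lemma least_word_exists n (J : TBT n) : exists s, least_word J s.
Proof.
case: J => [[Jl Jr] twin]; rewrite /least_word /reading_word /=.
have /and3P[/eqP nl /eqP nr _] := twin.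
rewrite -(shape_inorder_label 1 Jl) -(shape_inorder_label 1 Jr) in twin *.
have tw : twin_trees n (inorder_label 1 Jl) (inorder_label 1 Jr).
  by apply/is_twin_shape; rewrite ?labels_inorder_label ?nl ?nr.
have [s [ps el er least]] := exists_least_word tw.
by exists s; rewrite /P_symbol el er.
Qed.

Lemma P_symbol_bst_of n s t : is_perm_word n s -> is_perm_word n t ->
  P_symbol s = P_symbol t -> bst_of s = bst_of t /\ bst_of (rev s) = bst_of (rev t).
Proof.
move=> ps pt [el er]; split; apply: eq_shape_labels => //.
  by rewrite !(@labels_bst_of n).
by rewrite !(@labels_bst_of n) ?is_perm_word_rev.
Qed.

Lemma TBT_le_of_sub_inversions n (J K : TBT n) s t :
  reading_word J s -> reading_word K t ->
  (forall a b, is_inversion s a b -> is_inversion t a b) -> TBT_le J K.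
Proof.
move=> [ps Js] [pt Kt] sub; exists s, t.
have [us ut] := (is_perm_word_uniq ps, is_perm_word_uniq pt).
split=> //; [exact/is_P_symbolE|exact/is_P_symbolE|].
by apply: sub_inversions_permutohedron_le => //; rewrite (perm_trans ps) 1?perm_sym.
Qed.

(** The words that witness [TBT_le J K] may differ from [s] and [t]; the forced
    inversions carry the comparison over, as they only depend on [J] and [K]. *)
Lemma TBT_le_sub_inversions n (J K : TBT n) s t :
  least_word J s -> reading_word K t ->
  TBT_le J K -> forall a b, is_inversion s a b -> is_inversion t a b.
Proof.
move=> [[ps Js] least] [pt Kt] [s0 [s1 [ps0 ps1 Js0 Ks1 le01]]] a b /least.
have ut := is_perm_word_uniq pt; have us0 := is_perm_word_uniq ps0.
move/(is_P_symbolE _ us0): Js0; rewrite Js => /(P_symbol_bst_of ps ps0)[-> ->].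
move/(is_P_symbolE _ (is_perm_word_uniq ps1)): Ks1.
rewrite Kt => /(P_symbol_bst_of pt ps1)[el er].
apply: (clos_trans_closed (R := fun x y => is_inversion t x y)).
  move=> x y U0; apply: forced_word_is_inversion => //; rewrite el er.
  by apply: forced_word_mono U0 => //; [apply: permutohedron_le_perm|
    move=> ? ?; apply: permutohedron_le_sub_inversions].
by move=> x y z; apply: is_inversion_trans.
Qed.

Lemma TBT_le_refl n (J : TBT n) : TBT_le J J.
Proof.
have [s [rs _]] := least_word_exists J.
exact: (TBT_le_of_sub_inversions rs rs).
Qed.

Lemma TBT_le_trans n (J K L : TBT n) : TBT_le J K -> TBT_le K L -> TBT_le J L.
Proof.
have [s ls] := least_word_exists J; have [t lt_] := least_word_exists K.
have [u lu] := least_word_exists L; move=> JK KL.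
apply: (TBT_le_of_sub_inversions ls.1 lu.1) => a b /(TBT_le_sub_inversions ls lt_.1 JK).
exact: TBT_le_sub_inversions lt_ lu.1 KL a b.
Qed.

Lemma bst_of_before s t : uniq s -> perm_eq s t ->
  (forall x y, before s x y -> before t x y) -> bst_of s = bst_of t.
Proof.
move=> us st sub; have ut : uniq t by rewrite -(perm_uniq st).
apply: eq_bst_of => // [||x y]; first exact: sorted_labels_bst_of.
  exact: perm_trans (perm_labels_bst_of s) st.
by case/(is_ancestor_bst_of x y us) => /sub.
Qed.

Lemma TBT_le_anti n (J K : TBT n) : TBT_le J K -> TBT_le K J -> J = K.
Proof.
have [s ls] := least_word_exists J; have [t lt_] := least_word_exists K.
move=> /(TBT_le_sub_inversions ls lt_.1) st.
move=> /(TBT_le_sub_inversions lt_ ls.1) ts; apply: val_inj.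
case: ls lt_ => [[ps ->] _] [[pt ->] _].
have [us ut] := (is_perm_word_uniq ps, is_perm_word_uniq pt).
have pst : perm_eq s t by rewrite (perm_trans ps) 1?perm_sym.
have bef x y : before s x y -> before t x y.
  move=> bxy; have /andP[xs ys] := before_mem bxy; rewrite !(perm_mem pst) in xs ys.
  have [xy|yx|e] := ltngtP x y; last by have := before_neq us bxy; rewrite e eqxx.
    rewrite (beforeN ut) ?ltn_eqF //; apply/negP => byx.
    have /ts/andP[_] : is_inversion t x y by rewrite /is_inversion xy.
    by apply/negP/before_asym.
  by have /st/andP[] : is_inversion s y x by rewrite /is_inversion yx.
rewrite /P_symbol (bst_of_before us pst bef) (@bst_of_before (rev s) (rev t)) //.
- by rewrite rev_uniq.
- by rewrite perm_rev perm_sym perm_rev perm_sym.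
- by move=> x y; rewrite !before_rev; apply: bef.
Qed.

(** The words whose inversion set contains those of the least words of [J] and
    [K] contain the closure of their union, which is itself an inversion set. *)
Lemma TBT_join_exists n (J K : TBT n) :
  exists M, forall L, TBT_le M L <-> TBT_le J L /\ TBT_le K L.
Proof.
have [s ls] := least_word_exists J; have [t lt_] := least_word_exists K.
have [[[ps _] _] [[pt _] _]] := (ls, lt_).
pose G a b := is_inversion s a b || is_inversion t a b.
have G_mem a b : G a b -> 0 < a /\ a < b <= n.
  case/orP => /andP[ab /before_mem/andP[]].
    rewrite !(is_perm_word_mem _ ps); lia.
  rewrite !(is_perm_word_mem _ pt); lia.
have coG : cotransitive G.
  move=> a b c abc /orP[]; [move/(is_inversion_cotransitive ps abc) => []|
    move/(is_inversion_cotransitive pt abc) => []] => i;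
    by rewrite /G i ?orbT; auto.
have [w pw wE] := perm_of_inversions G_mem coG.
pose M : TBT n := exist _ (P_symbol w) (twin_P_symbol pw).
have rM : reading_word M w by [].
have Gw a b : G a b -> is_inversion w a b by move=> Gab; apply/wE/t_step.
have JM : TBT_le J M.
  by apply: (TBT_le_of_sub_inversions ls.1 rM) => a b i; apply: Gw; rewrite /G i.
have KM : TBT_le K M.
  by apply: (TBT_le_of_sub_inversions lt_.1 rM) => a b i; apply: Gw; rewrite /G i orbT.
exists M => L; split=> [ML|[JL KL]].
  by split; [apply: TBT_le_trans JM ML|apply: TBT_le_trans KM ML].
have [u [ru _]] := least_word_exists L.
apply: (TBT_le_of_sub_inversions rM ru) => a b /wE.
apply: (clos_trans_closed (R := fun x y => is_inversion u x y)) => [x y|x y z]; last first.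
  exact: is_inversion_trans (is_perm_word_uniq ru.1).
by case/orP; [apply: TBT_le_sub_inversions ls ru JL _ _|
  apply: TBT_le_sub_inversions lt_ ru KL _ _].
Qed.

Lemma is_twin_swap n (J : TBT n) : is_twin n ((val J).2, (val J).1).
Proof.
case: J => J /= /and3P[Jl Jr /forallP twin]; apply/and3P; split=> //.
by apply/forallP => i; rewrite eq_sym.
Qed.

Definition TBT_swap n (J : TBT n) : TBT n := Sub _ (is_twin_swap J).

Lemma TBT_swapK n : involutive (@TBT_swap n).
Proof. by move=> [[l r] Jt]; apply: val_inj. Qed.

Lemma reading_word_swap n (J : TBT n) s :
  reading_word J s -> reading_word (TBT_swap J) (rev s).
Proof.
move=> [ps Js]; split; first by rewrite is_perm_word_rev.
by rewrite /= Js /P_symbol revK.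
Qed.

Lemma TBT_le_swap n (J K : TBT n) :
  TBT_le J K -> TBT_le (TBT_swap K) (TBT_swap J).
Proof.
move=> [s [t [ps pt Js Kt st]]].
have [us ut] := (is_perm_word_uniq ps, is_perm_word_uniq pt).
have [ps' Js'] : reading_word (TBT_swap J) (rev s).
  by apply: reading_word_swap; split=> //; apply/is_P_symbolE.
have [pt' Kt'] : reading_word (TBT_swap K) (rev t).
  by apply: reading_word_swap; split=> //; apply/is_P_symbolE.
exists (rev t), (rev s); split=> //; [| |exact: permutohedron_le_rev].
  by apply/is_P_symbolE; rewrite ?rev_uniq.
by apply/is_P_symbolE; rewrite ?rev_uniq.
Qed.

Lemma TBT_meet_exists n (J K : TBT n) :
  exists M, forall L, TBT_le L M <-> TBT_le L J /\ TBT_le L K.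
Proof.
have [M ME] := TBT_join_exists (TBT_swap J) (TBT_swap K).
have swapE (A B : TBT n) : TBT_le A (TBT_swap B) <-> TBT_le B (TBT_swap A).
  by split=> /TBT_le_swap; rewrite TBT_swapK.
exists (TBT_swap M) => L; rewrite swapE ME.
by rewrite -(swapE L (TBT_swap J)) -(swapE L (TBT_swap K)) !TBT_swapK.
Qed.

(** * The lattice *)

Lemma is_lattice_of_bounds (T : Type) (le : T -> T -> Prop) :
  (forall x, le x x) -> (forall x y, le x y -> le y x -> x = y) ->
  (forall x y z, le x y -> le y z -> le x z) ->
  (forall x y, exists m, forall z, le z m <-> le z x /\ le z y) ->
  (forall x y, exists m, forall z, le m z <-> le x z /\ le y z) ->
  is_lattice le.
Proof.
move=> le_refl le_anti le_trans meets joins.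
pose d := Order.Disp tt tt.
pose leb x y := `[< le x y >].
pose E : choiceType := HB.pack T (gen_eqMixin T) (gen_choiceMixin T).
have refl : reflexive leb by move=> x; apply/asboolP.
have anti : antisymmetric leb.
  by move=> x y /andP[/asboolP xy /asboolP yx]; apply: le_anti.
have trans : transitive leb.
  by move=> y x z /asboolP xy /asboolP yz; apply/asboolP; apply: le_trans yz.
pose P : porderType d := HB.pack T (Choice.on E)
  (@Order.Le_isPOrder.Build d E leb refl anti trans).
pose meet x y := sval (cid (meets x y)); pose join x y := sval (cid (joins x y)).
have meetP (x y z : P) : (x <= meet y z)%O = (x <= y)%O && (x <= z)%O.
  rewrite /meet; case: cid => m mE /=; apply/asboolP/andP => [/mE[yx zx]|[]].
    by split; apply/asboolP.
  by move=> /asboolP xy /asboolP xz; apply/mE.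
have joinP (x y z : P) : ((join x y : P) <= z)%O = (x <= z)%O && (y <= z)%O.
  rewrite /join; case: cid => m mE /=; apply/asboolP/andP => [/mE[yx zx]|[]].
    by split; apply/asboolP.
  by move=> /asboolP xy /asboolP xz; apply/mE.
pose L : latticeType d := HB.pack T (Order.POrder.on P)
  (@Order.POrder_MeetJoin_isLattice.Build _ P meet join meetP joinP).
exists d, (Order.Lattice.class L) => x y.
split=> [xy|/asboolP//]; exact/asboolP.
Qed.

Theorem proposition5p5 (n : nat) : is_lattice (@TBT_le n).
Proof.
apply: is_lattice_of_bounds; first exact: TBT_le_refl.
- exact: TBT_le_anti.
- exact: TBT_le_trans.
- exact: TBT_meet_exists.
- exact: TBT_join_exists.
Qed.
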